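(* Let $p$ be a prime, $n\geq 3$ an integer, and let \[A=\mathbb{Z}\langle x,y\rangle/\left(I+(p,x,y)^n\right),\qquad I=(p,x,y)[x,y]\,\mathbb{Z}\langle x,y\rangle+\mathbb{Z}\langle x,y\rangle\,[x,y](p,x,y).\] Let $R$ be a homomorphic image of $A$ and $T$ a proper subring of $R$. Then $T$ is commutative.
   Context: All rings are associative with $1$, and subrings contain the identity element. $\mathbb{Z}\langle x,y\rangle$ is the free associative ring on $x,y$; $[x,y]=xy-yx$; $(p,x,y)$ is the two-sided ideal generated by $p,x,y$. *)

(* Defs.v *)
From HB Require Import structures.
From mathcomp Require Import all_boot all_order all_algebra.
From mathcomp Require Import boolp classical_sets.
From mathcomp Require Import monalg.

Set Implicit Arguments.
Unset Strict Implicit.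
Unset Printing Implicit Defensive.

Import GRing.Theory.
Local Open Scope classical_set_scope.
Local Open Scope quotient_scope.
Local Open Scope ring_scope.

Section Ideals.
Variable R : pzRingType.
Implicit Types A B : set R.

Definition add_subgroup A : Prop :=
  A 0 /\ forall u v, A u -> A v -> A (u - v).

Definition two_sided_ideal A : Prop :=
  add_subgroup A /\ forall a u, A u -> A (a * u) /\ A (u * a).

(* The intersection of all two-sided ideals containing A. *)
Definition ideal_gen A : set R := smallest two_sided_ideal A.

(* The product of two subsets: the finite sums of products a * b. *)
Definition set_prod A B : set R :=
  smallest add_subgroup [set a * b | a in A & b in B].

Definition set_sum A B : set R := [set a + b | a in A & b in B].

(* For an ideal A, set_exp A n is the usual A ^ n, with A ^ 0 the ring. *)
Definition set_exp A (n : nat) : set R := iter n (set_prod A) setT.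

Record ideal := Ideal {
  ideal_set : set R;
  idealP : two_sided_ideal ideal_set }.

Lemma smallest_add_subgroup A : add_subgroup (smallest add_subgroup A).
Proof.
split=> [B [[B0 _] _] //|u v Au Av B [Bg AB]].
by apply: Bg.2; [apply: Au|apply: Av].
Qed.

Lemma ideal_gen_ideal A : two_sided_ideal (ideal_gen A).
Proof.
split; first split=> [B [[[B0 _] _] _] //|u v Au Av B [Bi AB]].
  by apply: Bi.1.2; [apply: Au|apply: Av].
by move=> a u Au; split=> B [Bi AB]; have [] := Bi.2 a u (Au _ (conj Bi AB)).
Qed.

Lemma setT_ideal : two_sided_ideal setT.
Proof. by []. Qed.

Lemma set_prod_mull A B :
    (forall a u, A u -> A (a * u)) ->
  forall a u, set_prod A B u -> set_prod A B (a * u).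
Proof.
move=> Al c u ABu.
have [P0 PB] := smallest_add_subgroup [set a * b | a in A & b in B].
apply: (ABu (fun w => set_prod A B (c * w))); split.
  by split=> [|v w Pv Pw]; rewrite ?mulr0 // mulrBr; apply: PB.
move=> _ [a Aa [b Bb <-]] G [_ sG]; apply: sG.
by exists (c * a); [exact: Al|exists b => //; rewrite mulrA].
Qed.

Lemma set_prod_ideal A B :
    (forall a u, A u -> A (a * u)) -> (forall a u, B u -> B (u * a)) ->
  two_sided_ideal (set_prod A B).
Proof.
move=> Al Br; split=> [|c u ABu]; first exact: smallest_add_subgroup.
split; first exact: set_prod_mull.
have [P0 PB] := smallest_add_subgroup [set a * b | a in A & b in B].
apply: (ABu (fun w => set_prod A B (w * c))); split.
  by split=> [|v w Pv Pw]; rewrite ?mul0r // mulrBl; apply: PB.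
move=> _ [a Aa [b Bb <-]] G [_ sG]; apply: sG.
by exists a => //; exists (b * c); [exact: Br|rewrite mulrA].
Qed.

Lemma set_sum_ideal A B :
  two_sided_ideal A -> two_sided_ideal B -> two_sided_ideal (set_sum A B).
Proof.
move=> [[A0 AB] AM] [[B0 BB] BM]; split; first split.
- by exists 0 => //; exists 0 => //; rewrite addr0.
- move=> _ _ [a Aa [b Bb <-]] [a' Aa' [b' Bb' <-]].
  exists (a - a'); first exact: AB.
  by exists (b - b'); [exact: BB|rewrite opprD addrACA].
- move=> c _ [a /(AM c)[Aca Aac] [b /(BM c)[Bcb Bbc] <-]]; split.
    by exists (c * a) => //; exists (c * b) => //; rewrite mulrDr.
  by exists (a * c) => //; exists (b * c) => //; rewrite mulrDl.
Qed.

Lemma set_exp_ideal A n : two_sided_ideal A -> two_sided_ideal (set_exp A n).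
Proof.
move=> [_ AM]; elim: n => [|n [_ IHn]]; first exact: setT_ideal.
by apply: set_prod_ideal => a u; [move/(AM a)=> []|move/(IHn a)=> []].
Qed.

End Ideals.

(* MathComp's ring quotient covers commutative rings only. Its additive *)
(* quotient is reused here and given the induced multiplication.        *)
Section RingQuotient.
Variables (R : pzRingType) (I : ideal R).

Definition ideal_pred : {pred R} := fun x => `[< ideal_set I x >].

Lemma ideal_predP x : reflect (ideal_set I x) (x \in ideal_pred).
Proof. exact: asboolP. Qed.

Fact ideal_zmod_closed : zmod_closed ideal_pred.
Proof.
have [[I0 IB] _] := idealP I; split; first exact/ideal_predP.
by move=> u v /ideal_predP Iu /ideal_predP Iv; apply/ideal_predP/IB.
Qed.
HB.instance Definition _ := GRing.isZmodClosed.Build R ideal_pred ideal_zmod_closed.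

Definition quotient_ring : Type := Quotient.quot ideal_pred.
HB.instance Definition _ := GRing.Zmodule.on quotient_ring.
HB.instance Definition _ :=
  EqQuotient.copy quotient_ring (Quotient.quot ideal_pred).

Definition qpi (x : R) : quotient_ring := \pi_(Quotient.quot ideal_pred) x.

Lemma qpiP x y : qpi x = qpi y <-> ideal_set I (x - y).
Proof.
split=> [/eqP|Ixy]; first by rewrite -Quotient.idealrBE => /ideal_predP.
by apply/eqP; rewrite -Quotient.idealrBE; apply/ideal_predP.
Qed.

Definition qmul (a b : quotient_ring) : quotient_ring := qpi (repr a * repr b).

Lemma qpi_repr a : qpi (repr a) = a.
Proof. exact: reprK. Qed.

Lemma qpiD x y : qpi (x + y) = qpi x + qpi y.
Proof. exact: raddfD. Qed.

Lemma qpiM x y : qpi (x * y) = qmul (qpi x) (qpi y).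
Proof.
have [[I0 IB] IM] := idealP I.
rewrite /qmul; set x' := repr _; set y' := repr _.
have Ix : ideal_set I (x - x') by apply/qpiP; rewrite qpi_repr.
have Iy : ideal_set I (y' - y) by apply/qpiP; rewrite qpi_repr.
apply/qpiP; have -> : x * y - x' * y' = (x - x') * y - x' * (y' - y).
  by rewrite mulrBl mulrBr opprB addrA subrK.
by apply: IB; [apply: (IM y _ Ix).2|apply: (IM x' _ Iy).1].
Qed.

Fact qmulA : associative qmul.
Proof.
by move=> a b c; rewrite -[a]qpi_repr -[b]qpi_repr -[c]qpi_repr -!qpiM mulrA.
Qed.
Fact qmul1 : left_id (qpi 1) qmul.
Proof. by move=> a; rewrite -[a]qpi_repr -qpiM mul1r. Qed.
Fact qmulr1 : right_id (qpi 1) qmul.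
Proof. by move=> a; rewrite -[a]qpi_repr -qpiM mulr1. Qed.
Fact qmulDl : left_distributive qmul +%R.
Proof.
move=> a b c; rewrite -[a]qpi_repr -[b]qpi_repr -[c]qpi_repr.
by rewrite -qpiD -!qpiM mulrDl qpiD.
Qed.
Fact qmulDr : right_distributive qmul +%R.
Proof.
move=> a b c; rewrite -[a]qpi_repr -[b]qpi_repr -[c]qpi_repr.
by rewrite -qpiD -!qpiM mulrDr qpiD.
Qed.

HB.instance Definition _ := GRing.Zmodule_isPzRing.Build quotient_ring
  qmulA qmul1 qmulr1 qmulDl qmulDr.

Fact qpi_zmod_morphism : zmod_morphism qpi.
Proof. by move=> x y; apply: raddfB. Qed.
HB.instance Definition _ :=
  GRing.isZmodMorphism.Build R quotient_ring qpi qpi_zmod_morphism.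
Fact qpi_monoid_morphism : monoid_morphism qpi.
Proof. by split=> // x y; apply: qpiM. Qed.
HB.instance Definition _ :=
  GRing.isMonoidMorphism.Build R quotient_ring qpi qpi_monoid_morphism.

End RingQuotient.

(* Z<x,y> is the monoid ring over Z of the free monoid on two letters, *)
(* false for x and true for y.                                         *)
Definition freeZ2 : nzRingType := {malg int[{fmonom bool}]}.
Definition gx : freeZ2 := << fmu false >>.
Definition gy : freeZ2 := << fmu true >>.
Definition commxy : freeZ2 := gx * gy - gy * gx.

Section TheRing.
Variables p n : nat.

Definition Jpxy : set freeZ2 := ideal_gen [set p%:R; gx; gy].

Definition Ipxy : set freeZ2 :=
  set_sum (set_prod (set_prod Jpxy [set commxy]) setT)
          (set_prod (set_prod setT [set commxy]) Jpxy).

Fact relations_ideal : two_sided_ideal (set_sum Ipxy (set_exp Jpxy n)).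
Proof.
have JI : two_sided_ideal Jpxy by exact: ideal_gen_ideal.
apply: set_sum_ideal; last exact: set_exp_ideal.
apply: set_sum_ideal; apply: set_prod_ideal => //.
- by apply: set_prod_mull => a u /(JI.2 a)[].
- exact: set_prod_mull.
- by move=> a u /(JI.2 a)[].
Qed.

Definition ringA : pzRingType := quotient_ring (Ideal relations_ideal).

End TheRing.

(* Main.v *)
Require Import Defs.
From mathcomp Require Import all_boot all_order all_algebra.
From mathcomp Require Import boolp classical_sets.
From mathcomp Require Import monalg.

Set Implicit Arguments.
Unset Strict Implicit.
Unset Printing Implicit Defensive.

Import GRing.Theory.
Local Open Scope classical_set_scope.
Local Open Scope ring_scope.

(** Let J be the image of (p, x, y) in R. Commutators of R are multiples of
    c = [x, y], which is killed by J on both sides, so products of two elements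
    of J are central and [a + b x + d y + w, a' + b' x + d' y + w'] equals
    (b d' - b' d) c for integers a, b, ... and w, w' in J^2. As p c = 0, two
    noncommuting elements of T have linear parts independent mod p, which gives
    J = (J :&: T) + J^2. Since J is nilpotent, a Nakayama argument yields that T
    contains J, hence T = Z + J = R. To avoid transporting ideals to R, the
    argument is run in a ring F generated by x and y, modulo an ideal N, on the
    preimage of T. *)

(** * Additive subgroups, powers of an ideal and a Nakayama argument *)

Section IdealPowers.
Variable R : pzRingType.
Implicit Types A B J T : set R.

Lemma add_subgroupD A u v : add_subgroup A -> A u -> A v -> A (u + v).
Proof.
move=> [A0 AB] Au Av; rewrite -[v]opprK; apply: (AB) => //.
by rewrite -sub0r; apply: AB.
Qed.

Lemma add_subgroupMz A u (k : int) : add_subgroup A -> A u -> A (u *~ k).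
Proof.
move=> Aa Au; have AMn m : A (u *+ m).
  elim: m => [|m IHm]; first by rewrite mulr0n; apply: Aa.1.
  by rewrite mulrS; apply: add_subgroupD.
case: k => m; first exact: AMn.
by rewrite NegzE mulrNz -sub0r; apply: Aa.2; [apply: Aa.1 | apply: AMn].
Qed.

Lemma add_subgroup_coprimez A u (k l : int) :
  add_subgroup A -> coprimez k l -> A (u *~ k) -> A (u *~ l) -> A u.
Proof.
move=> Aa /eqP kl Ak Al; have [a [b ab]] := Bezoutz k l.
rewrite -[u]mulr1z -[1]kl -ab mulrzDr [a * k]mulrC [b * l]mulrC !mulrzA.
by apply: add_subgroupD => //; apply: add_subgroupMz.
Qed.

Lemma set_prodM A B a b : A a -> B b -> set_prod A B (a * b).
Proof. by move=> Aa Bb C [_]; apply; exists a => //; exists b. Qed.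

Lemma set_prod_sub A B C : add_subgroup C ->
  (forall a b, A a -> B b -> C (a * b)) -> set_prod A B `<=` C.
Proof.
by move=> Ca AB; apply: smallest_sub => // _ [a Aa [b Bb <-]]; apply: AB.
Qed.

Lemma set_exp1 J : two_sided_ideal J -> set_exp J 1 = J.
Proof.
move=> [Ja JM]; apply/seteqP; split.
  by apply: set_prod_sub => // a b /(JM b)[].
by move=> u Ju; rewrite -[u]mulr1; apply: set_prodM.
Qed.

Lemma set_expS J k a b : J a -> set_exp J k b -> set_exp J k.+1 (a * b).
Proof. exact: set_prodM. Qed.

(** [set_exp J 2] is [J (J R)], and the inner [J R] is [J] itself, so testing products of two
    elements of [J] suffices. *)
Lemma set_exp2_sub J C : two_sided_ideal J -> add_subgroup C ->
  (forall a b, J a -> J b -> C (a * b)) -> set_exp J 2 `<=` C.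
Proof.
move=> Ji Ca JJ; apply: set_prod_sub => // a b Ja Jb.
by apply: JJ => //; rewrite -(set_exp1 Ji).
Qed.

(** Induction on [k]: with [a = t + s] and [b = t' + s'], where [t] and [t'] lie in [T], one has
    [a b = t t' + (t s' + s b)], and the bracket lies one power of [J] deeper. *)
Lemma set_exp_split J T : two_sided_ideal J -> add_subgroup T ->
    (forall u v, T u -> T v -> T (u * v)) ->
    J `<=` set_sum (J `&` T) (set_exp J 2) ->
  forall k, set_exp J k.+1 `<=` set_sum (set_exp J k.+1 `&` T) (set_exp J k.+2).
Proof.
move=> Ji Ta TM JT; have Ea k := (set_exp_ideal k Ji).1.
elim=> [|k IHk]; first by rewrite set_exp1.
have SumT : add_subgroup (set_sum (set_exp J k.+2 `&` T) (set_exp J k.+3)).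
  split.
    by exists 0; [split; [apply: (Ea _).1 | apply: Ta.1]
                 |exists 0; [apply: (Ea _).1 | rewrite addr0]].
  move=> _ _ [a [Ja Tx] [b Jb <-]] [a' [Ja' Tx'] [b' Jb' <-]].
  exists (a - a'); first by split; [apply: (Ea _).2 | apply: Ta.2].
  by exists (b - b'); [apply: (Ea _).2 | rewrite opprD addrACA].
apply: (set_prod_sub SumT) => a b Ja Jb.
have [t [Jt Tt] [s Js ats]] := JT a Ja.
have [t' [Jt' Tt'] [s' Js' bts]] := IHk b Jb.
exists (t * t'); first by split; [apply: set_expS | apply: TM].
exists (t * s' + s * b); last by rewrite addrA -mulrDr bts -mulrDl ats.
apply: (add_subgroupD (Ea k.+3)); first exact: set_expS.
(* Powers of [J] associate to the right, so [s * b] is handled by fixing [b] and reducing [s] to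
   products [j * j']. *)
have : [set w | set_exp J k.+3 (w * b)] s; last by [].
apply: set_exp2_sub Js => //=.
  split=> [|v w Jv Jw]; first by rewrite /= mul0r; apply: (Ea k.+3).1.
  by rewrite /= mulrBl; apply: (Ea k.+3).2.
move=> j j' Jj Jj' /=; rewrite -mulrA.
exact: (@set_expS _ k.+2 _ _ Jj (@set_expS _ k.+1 _ _ Jj' Jb)).
Qed.

(** Descent on the exponent: an element of [J^(k+1)] is in [T] up to [J^(k+2)], which is already
    inside [T]. *)
Lemma nilpotent_nakayama J T n : two_sided_ideal J -> add_subgroup T ->
    (forall u v, T u -> T v -> T (u * v)) ->
    J `<=` set_sum (J `&` T) (set_exp J 2) -> set_exp J n `<=` T -> J `<=` T.
Proof.
move=> Ji Ta TM JT; have split_exp := set_exp_split Ji Ta TM JT.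
elim: n => [TT u _|[|n] IHn JnT]; [exact: TT | by rewrite -(set_exp1 Ji) |].
apply: IHn => u /split_exp[t [_ Tt] [s Js <-]].
by apply: add_subgroupD => //; apply: JnT.
Qed.

End IdealPowers.

(** Phrased so as to serve directly as an induction principle on the elements of [F]. *)
Definition generates2 (F : pzRingType) (x y : F) : Prop :=
  forall S : set F, S 1 -> (forall u v, S u -> S v -> S (u - v)) ->
    (forall u v, S u -> S v -> S (u * v)) -> S x -> S y -> forall u, S u.

(** Every element is an integer combination of words, and words are products of letters. *)
Lemma freeZ2_generates : generates2 gx gy.
Proof.
move=> S S1 SB SM Sx Sy u.
have Sa : add_subgroup S by split=> //; rewrite -(subrr 1); apply: SB.
have Smon (m : {fmonom bool}) : S << m >>.
  case: m => s; elim: s => [|b s IHs]; first by rewrite -fmoneE.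
  have -> : << FMonom (b :: s) >> = << fmu b >> * << FMonom s >> :> freeZ2.
    rewrite [RHS]malgM_def fgmulUU mulr1; congr << _ >>.
    by rewrite [RHS]fmmulE fmuE.
  by apply: SM; [case: b; [exact: Sy | exact: Sx] | exact: IHs].
rewrite [u]monalgE; elim/big_ind: _ => [|v w Sv Sw|m _].
- exact: Sa.1.
- exact: add_subgroupD Sa Sv Sw.
have -> : << u@_m *g m >> = << m >> *~ u@_m :> freeZ2.
  by rewrite -[u@_m in LHS]intz; apply: (raddfMz (mkmalgU m)).
exact: add_subgroupMz Sa (Smon m).
Qed.

(** * Commutators and linear parts in a two-generated ring *)

Section TwoGenerated.
Variables (F : pzRingType) (x y : F).
Hypothesis genF : generates2 x y.
Local Notation c := (x * y - y * x).

(** By the Leibniz rule, for fixed [u] the [v] with [[u, v]] in [C] form a subring. This is applied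
    to [u = x], to [u = y], then to any [u] by antisymmetry. *)
Lemma ideal_comm (C : set F) : two_sided_ideal C -> C c ->
  forall u v, C (u * v - v * u).
Proof.
move=> [Ca CM] Cc.
have CN w : C w -> C (- w) by rewrite -sub0r; apply: Ca.2; apply: Ca.1.
have CS u : C (u * x - x * u) -> C (u * y - y * u) ->
    forall v, C (u * v - v * u).
  move=> Cx Cy; apply: genF => //= [|v w Cv Cw|v w Cv Cw].
  - by rewrite mulr1 mul1r subrr; apply: Ca.1.
  - have -> : u * (v - w) - (v - w) * u = u * v - v * u - (u * w - w * u).
      by rewrite mulrBr mulrBl !opprD !opprK addrACA.
    exact: Ca.2.
  - have -> : u * (v * w) - v * w * u
        = (u * v - v * u) * w + v * (u * w - w * u).
      by rewrite mulrBl mulrBr !mulrA addrA subrK.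
    by apply: add_subgroupD => //; [apply: (CM w _ Cv).2 | apply: (CM v _ Cw).1].
have C0 u : C (u * u - u * u) by rewrite subrr; apply: Ca.1.
have Cx v : C (x * v - v * x) by apply: CS.
have Cy v : C (y * v - v * y) by apply: CS => //; rewrite -opprB; apply: CN.
by move=> u; apply: CS; rewrite -opprB; apply: CN.
Qed.

Definition affine (a b d : int) : F :=
  1 *~ a + (x *~ b + y *~ d).

Lemma affineB (a b d a' b' d' : int) :
  affine (a - a') (b - b') (d - d') = affine a b d - affine a' b' d'.
Proof. by rewrite /affine !mulrzBr !opprD [RHS]addrACA [X in _ = _ + X]addrACA. Qed.

Variable p : nat.
Local Notation J := (ideal_gen [set p%:R; x; y]).

Lemma J_ideal : two_sided_ideal J.
Proof. exact: ideal_gen_ideal. Qed.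

Lemma J_p : J p%:R.
Proof. by apply: sub_gen_smallest; left; left. Qed.

Lemma J_x : J x.
Proof. by apply: sub_gen_smallest; left; right. Qed.

Lemma J_y : J y.
Proof. by apply: sub_gen_smallest; right. Qed.

Lemma J_lin (b d : int) : J (x *~ b + y *~ d).
Proof.
have Ja := J_ideal.1.
by apply: (add_subgroupD Ja); apply: (add_subgroupMz _ Ja);
  [apply: J_x | apply: J_y].
Qed.

Lemma J2M u v : J u -> J v -> set_exp J 2 (u * v).
Proof.
by move=> Ju Jv; apply: set_expS => //; rewrite set_exp1 //; apply: J_ideal.
Qed.

(** For [z] in [J], modulo [J^2] the product [z * w] depends only on the constant term of [w], so
    left multiplication by [x] or [y] preserves affine form. *)
Lemma affineP u :
  exists a b d : int, set_exp J 2 (u - affine a b d).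
Proof.
have [[E0 EB] EM] := set_exp_ideal 2 J_ideal.
pose P := [set w | exists a b d : int, set_exp J 2 (w - affine a b d)].
have PB v w : P v -> P w -> P (v - w).
  move=> [a [b [d Ev]]] [a' [b' [d' Ew]]].
  exists (a - a'), (b - b'), (d - d').
  have -> : v - w - affine (a - a') (b - b') (d - d')
      = v - affine a b d - (w - affine a' b' d').
    by rewrite affineB !opprD !opprK addrACA.
  exact: EB.
have P1 : P 1.
  by exists 1, 0, 0; rewrite /affine !mulr0z !addr0 mulr1z subrr.
have step z : J z -> forall w, P w -> exists a : int, set_exp J 2 (z * w - z *~ a).
  move=> Jz w [a [b [d Ew]]]; exists a.
  have -> : z * w - z *~ a
      = z * (w - affine a b d) + z * (x *~ b + y *~ d).
    by rewrite mulrBr mulrDr mulrzr opprD addrA addrNK.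
  apply: (add_subgroupD (conj E0 EB)); first exact: (EM z _ Ew).1.
  by apply: J2M => //; apply: J_lin.
(* Generation is applied to the multipliers preserving [P], for which closure under product is mere
   composition. *)
suff Pu : forall w, P w -> P (u * w) by rewrite -[u]mulr1; apply: (Pu 1 P1).
move: u; apply: genF => /=.
- by move=> w; rewrite mul1r.
- by move=> v z Pv Pz w Pw; rewrite mulrBl; apply: PB; [apply: Pv | apply: Pz].
- by move=> v z Pv Pz w Pw; rewrite -mulrA; apply/Pv/Pz.
- move=> w /(step _ J_x)[a Ea]; exists 0, a, 0.
  by rewrite /affine !mulr0z addr0 add0r.
- move=> w /(step _ J_y)[a Ea]; exists 0, 0, a.
  by rewrite /affine !mulr0z !add0r.
Qed.

(** [N] stands for the ideal of relations defining the ring [A]. *)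
Variable N : set F.
Hypothesis Nideal : two_sided_ideal N.
Hypothesis Nc : forall u, J u -> N (u * c) /\ N (c * u).

(** The elements that [J] kills on both sides modulo [N] form an ideal; it contains [c], hence all
    commutators. *)
Lemma rel_comm u v w : J w -> N (w * (u * v - v * u)) /\ N ((u * v - v * u) * w).
Proof.
have [[N0 NB] NM] : two_sided_ideal N := Nideal.
move=> Jw; have JM a e := J_ideal.2 a e.
pose C := [set e | forall w, J w -> N (w * e) /\ N (e * w)].
suff CF : C (u * v - v * u) by apply: (CF w Jw).
apply: (@ideal_comm C); last exact: Nc.
split; first split=> [z _|e e' Ce Ce' z Jz].
- by rewrite mulr0 mul0r.
- have [ze ez] := Ce z Jz; have [ze' ez'] := Ce' z Jz.
  by rewrite mulrBr mulrBl; split; apply: NB.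
- move=> r e Ce; split=> z Jz; have [rz zr] := JM r z Jz;
    have [ze ez] := Ce z Jz; split.
  + by rewrite mulrA; apply: (Ce _ zr).1.
  + by rewrite -mulrA; apply: (NM r _ ez).1.
  + by rewrite mulrA; apply: (NM r _ ze).2.
  + by rewrite -mulrA; apply: (Ce _ rz).2.
Qed.

(** In [[j j', v] = j [j', v] + [j, v] j'] both terms vanish modulo [N] by [rel_comm]. *)
Lemma rel_comm_exp2 w v : set_exp J 2 w -> N (w * v - v * w).
Proof.
have Na : add_subgroup N := Nideal.1.
apply: (@set_exp2_sub _ J [set w | N (w * v - v * w)]).
- exact: J_ideal.
- split=> [|u u' Nu Nu'] /=; first by rewrite mulr0 mul0r subrr; apply: Na.1.
  have -> : (u - u') * v - v * (u - u') = u * v - v * u - (u' * v - v * u').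
    by rewrite mulrBr mulrBl !opprD !opprK addrACA.
  exact: Na.2.
- move=> j j' Jj Jj' /=.
  have -> : j * j' * v - v * (j * j')
      = j * (j' * v - v * j') + (j * v - v * j) * j'.
    by rewrite mulrBl mulrBr !mulrA addrA subrK.
  apply: (add_subgroupD Na); first exact: (rel_comm _ _ Jj).1.
  exact: (rel_comm _ _ Jj').2.
Qed.

(** Integers are central, so only the linear parts contribute, through their determinant. *)
Lemma affine_commutator (a b d a' b' d' : int) :
  affine a b d * affine a' b' d' - affine a' b' d' * affine a b d
    = c *~ (b * d' - b' * d).
Proof.
rewrite /affine; set l := x *~ b + _; set l' := x *~ b' + _.
have -> : (1 *~ a + l) * (1 *~ a' + l') - (1 *~ a' + l') * (1 *~ a + l)
    = l * l' - l' * l.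
  have shift u v k : (1 *~ k + u) * v - v * (1 *~ k + u) = u * v - v * u.
    by rewrite mulrDl mulrDr mulrzl mulrzr opprD addrACA subrr add0r.
  by rewrite shift -opprB shift opprB.
rewrite /l /l' !mulrDl !mulrDr !(mulrzAl, mulrzAr) -!mulrzA opprD addrACA.
rewrite ![_ * b]mulrC ![_ * d]mulrC [_ + x * y *~ (b * d')]addrC.
rewrite [y * x *~ (b * d') + _]addrC !addrKA -!mulrzBr.
by rewrite -[d * b' - b * d']opprB mulrNz -mulrzBl.
Qed.

Lemma affine_comm (a b d a' b' d' : int) : (p %| b * d' - b' * d)%Z ->
  N (affine a b d * affine a' b' d' - affine a' b' d' * affine a b d).
Proof.
move=> /dvdzP[q kE]; rewrite affine_commutator kE [q * _]mulrC mulrzA.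
apply: (add_subgroupMz _ Nideal.1); rewrite -pmulrn -mulr_natr.
exact: (Nc J_p).2.
Qed.

Lemma noncomm_subring_full (n : nat) (T : set F) : prime p ->
    add_subgroup T -> T 1 -> (forall u v, T u -> T v -> T (u * v)) ->
    N `<=` T -> set_exp J n `<=` N ->
  (exists u v, [/\ T u, T v & ~ N (u * v - v * u)]) -> T = setT.
Proof.
move=> p_pr Ta T1 TM NT JnN [u [v [Tu Tv uvN]]].
have Ji := J_ideal; have [Ja JM] := Ji.
have [J2a J2M'] := set_exp_ideal 2 Ji; have Na := Nideal.1.
have J2J : set_exp J 2 `<=` J.
  by apply: set_exp2_sub => // s t /(JM t)[].
have TZ (a : int) : T (1 *~ a) by apply: (add_subgroupMz _ Ta).
have subr_const w (a b d : int) :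
    w - 1 *~ a = w - affine a b d + (x *~ b + y *~ d).
  by rewrite /affine opprD [w + (_ + _)]addrA subrK.
(* The Nakayama hypothesis is that [K] contains [J]; once [K] is an ideal, it is enough to find [p],
   [x] and [y] in it. *)
pose K := set_sum (J `&` T) (set_exp J 2).
have JTK w : J w -> T w -> K w.
  by move=> Jw Tw; exists w => //; exists 0; [exact: J2a.1 | rewrite addr0].
have J2K w : set_exp J 2 w -> K w.
  move=> Ew; exists 0; first by split; [exact: Ja.1 | exact: Ta.1].
  by exists w; [exact: Ew | rewrite add0r].
have Ki : two_sided_ideal K.
  split; first split.
  - exact: (J2K _ J2a.1).
  - move=> _ _ [t [Jt Tt] [s Es <-]] [t' [Jt' Tt'] [s' Es' <-]].
    exists (t - t'); first by split; [apply: Ja.2 | apply: Ta.2].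
    by exists (s - s'); [apply: J2a.2 | rewrite opprD addrACA].
  (* Modulo [J^2], multiplying [t] by [r] amounts to multiplying it by the integer constant term [a]
     of [r]. *)
  - move=> r _ [t [Jt Tt] [s Es <-]]; have [a [b [d Er]]] := affineP r.
    have Jr : J (r - 1 *~ a).
      rewrite (subr_const _ _ b d).
      by apply: (add_subgroupD Ja); [apply: J2J | apply: J_lin].
    have JTa : (J `&` T) (t *~ a).
      by split; [apply: (add_subgroupMz _ Ja) | apply: (add_subgroupMz _ Ta)].
    split; exists (t *~ a) => //.
      exists ((r - 1 *~ a) * t + r * s).
        by apply: (add_subgroupD J2a); [apply: J2M | apply: (J2M' r _ Es).1].
      by rewrite mulrBl mulrzl addrA [t *~ a + _]addrC subrK mulrDr.
    exists (t * (r - 1 *~ a) + s * r).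
      by apply: (add_subgroupD J2a); [apply: J2M | apply: (J2M' r _ Es).2].
    by rewrite mulrBr mulrzr addrA [t *~ a + _]addrC subrK mulrDl.
have Ka := Ki.1.
(* Since [T] contains the integers, removing the constant term of [w] leaves an element of both [J]
   and [T]. *)
have Klin w a b d : T w -> set_exp J 2 (w - affine a b d) ->
    K (x *~ b + y *~ d).
  move=> Tw Ew.
  have -> : x *~ b + y *~ d = w - 1 *~ a - (w - affine a b d).
    by rewrite (subr_const _ _ b d) addrAC subrr add0r.
  apply: Ka.2; last exact: J2K.
  apply: JTK; last by apply: Ta.2 => //; apply: TZ.
  by rewrite (subr_const _ _ b d); apply: (add_subgroupD Ja); [apply: J2J | apply: J_lin].
have [a [b [d Eu]]] := affineP u; have [a' [b' [d' Ev]]] := affineP v.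
pose k := b * d' - b' * d.
(* Otherwise [p] divides the determinant and the affine parts commute modulo [N]; the remainders in
   [J^2] are central there, so [u] and [v] would commute too. *)
have pk : coprimez k p.
  rewrite coprimezE coprime_sym prime_coprime //; apply/negP => pk; apply: uvN.
  have commD s t r : (s + t) * r - r * (s + t) = (s * r - r * s) + (t * r - r * t).
    by rewrite mulrDl mulrDr opprD addrACA.
  rewrite -[u](subrK (affine a b d)) commD; apply: (add_subgroupD Na).
    exact: rel_comm_exp2.
  rewrite -opprB -[v](subrK (affine a' b' d')) commD opprD.
  apply: (add_subgroupD Na); last by rewrite opprB; apply: affine_comm.
  by rewrite -sub0r; apply: Na.2; [exact: Na.1 | apply: rel_comm_exp2].
have Kp z : J z -> K (z *~ p).
  by move=> Jz; rewrite -pmulrn -mulr_natr; apply: J2K; exact: (J2M Jz J_p).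
have Kb := Klin _ _ _ _ Tu Eu; have Kb' := Klin _ _ _ _ Tv Ev.
(* Cramer's rule puts [k x] in [K], and [p x] is in [J^2]; Bezout then gives [x]. *)
have Kx : K x.
  apply: (add_subgroup_coprimez Ka pk); last exact: (Kp _ J_x).
  have -> : x *~ k = (x *~ b + y *~ d) *~ d' - (x *~ b' + y *~ d') *~ d.
    by rewrite !mulrzDl -!mulrzA opprD addrACA [d * d']mulrC subrr addr0 -mulrzBr.
  by apply: Ka.2; apply: (add_subgroupMz _ Ka).
have Ky : K y.
  apply: (add_subgroup_coprimez Ka pk); last exact: (Kp _ J_y).
  have -> : y *~ k = (x *~ b' + y *~ d') *~ b - (x *~ b + y *~ d) *~ b'.
    rewrite !mulrzDl -!mulrzA opprD addrACA [b' * b]mulrC subrr add0r -mulrzBr.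
    by rewrite [d' * b]mulrC [d * b']mulrC.
  by apply: Ka.2; apply: (add_subgroupMz _ Ka).
have JK : J `<=` K.
  apply: smallest_sub => // _ [[->|->]|->] //; apply: JTK; first exact: J_p.
  by rewrite pmulrn; apply: TZ.
have JT : J `<=` T.
  by apply: (nilpotent_nakayama Ji Ta TM JK (n := n)) => w /JnN/NT.
apply/seteqP; split=> // z _; have [e [f [g Ez]]] := affineP z.
rewrite -[z](subrK (affine e f g)); apply: (add_subgroupD Ta).
  exact: (JT _ (J2J _ Ez)).
apply: (add_subgroupD Ta); first exact: TZ.
exact: (JT _ (J_lin _ _)).
Qed.

End TwoGenerated.

(** * Transfer to the homomorphic images of [A] *)

Lemma rel_commxy (p n : nat) u : Jpxy p u ->
  set_sum (Ipxy p) (set_exp (Jpxy p) n) (u * commxy) /\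
  set_sum (Ipxy p) (set_exp (Jpxy p) n) (commxy * u).
Proof.
move=> Ju; have E0 := (set_exp_ideal n (ideal_gen_ideal [set p%:R; gx; gy])).1.1.
have S0 A : smallest (@add_subgroup freeZ2) A 0 := (smallest_add_subgroup A).1.
split.
  exists (u * commxy); last by exists 0; [exact: E0 | rewrite addr0].
  exists (u * commxy); last by exists 0; [exact: S0 | rewrite addr0].
  (* [u c] is read as [(u c) 1] in the first summand of [Ipxy]; below, [c u] is [(1 c) u] in the
     second. *)
  by rewrite -[u * _]mulr1; do 2![apply: set_prodM; last by []].
exists (commxy * u); last by exists 0; [exact: E0 | rewrite addr0].
exists 0; first exact: S0; exists (commxy * u); last by rewrite add0r.
apply: set_prodM; last exact: Ju.
by have := @set_prodM freeZ2 setT [set commxy] 1 commxy I erefl; rewrite mul1r.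
Qed.

Theorem proposition2p10 (p n : nat) (hp : prime p) (hn : (3 <= n)%N)
    (R : pzRingType) (f : {rmorphism ringA p n -> R})
    (hf : range f = [set: R])
    (T : {pred R}) (hT : GRing.subring_closed T)
    (hproper : exists r : R, r \notin T) :
  {in T &, commutative (@GRing.mul R)}.
Proof.
have [T1 TB TM] := hT.
pose I := Ideal (relations_ideal p n).
have [g gE] : exists g : {rmorphism freeZ2 -> R}, forall u, g u = f (qpi I u).
  by exists (f \o qpi I : {rmorphism _ -> _}).
pose S : set freeZ2 := [set u | g u \in T].
have Sa : add_subgroup S.
  split=> [|u v Su Sv]; first by rewrite /S /= rmorph0 -(subrr 1) TB.
  by rewrite /S /= rmorphB TB.
have g_surj r : exists u, g u = r.
  have : range f r by rewrite hf.
  by case=> a _ <-; exists (repr a); rewrite gE qpi_repr.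
have [S1 SM] : S 1 /\ forall u v, S u -> S v -> S (u * v).
  by split=> [|u v Su Sv]; rewrite /S /= ?rmorph1 // rmorphM TM.
have gN u : set_sum (Ipxy p) (set_exp (Jpxy p) n) u -> g u = 0.
  move=> Nu; rewrite gE -(rmorph0 f) -(rmorph0 (qpi I)); congr (f _).
  by apply/qpiP; rewrite subr0.
move=> r s Tr Ts; have [[u ur] [v vs]] := (g_surj r, g_surj s).
have [//|rs] := pselect (r * s = s * r).
have [z /negP[]] := hproper; have [w <-] := g_surj z.
(* A noncommuting pair in [T] would make its preimage [S] everything, whereas [w] maps outside
   [T]. *)
suff ST : S = setT by change (S w); rewrite ST.
apply: (noncomm_subring_full freeZ2_generates (relations_ideal p n)
  (@rel_commxy p n) (n := n)) => //.
- by move=> e Ne; rewrite /S /= gN // -(subrr 1) TB.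
- move=> e Je; exists 0; last by exists e; rewrite ?add0r.
  by exists 0; [|exists 0; rewrite ?addr0 //];
    apply: (smallest_add_subgroup _).1.
exists u, v; split; rewrite /S /= ?ur ?vs //.
move/gN; rewrite rmorphB !rmorphM ur vs => /eqP; rewrite subr_eq0 => /eqP.
exact: rs.
Qed.
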